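(* Assume $n\ge 2$. Define $\nu_n:\mathbb{P}^1_{\mathbb{C}}\times Z_n\to\mathbb{P}^{n+2}_{\mathbb{C}}$ by $$\nu_n([a:b],[x_0:\cdots:x_{n+2}])=[(b\lambda_0-a)x_0:\cdots:(b\lambda_{n+2}-a)x_{n+2}].$$ Then the image of $\nu_n$ is $W$. Consequently, if $n\ge3$, then $W$ is irreducible.
   Context: Let $\lambda_0,\dots,\lambda_{n+2}\in\mathbb{C}$ be pairwise distinct. Let $X=\{\sum_{j=0}^{n+2} x_j^2=0,\ \sum_{j=0}^{n+2}\lambda_j x_j^2=0\}\subset\mathbb{P}^{n+2}_{\mathbb{C}}$, smooth of dimension $n$. For $x\in X$ put $p_x(z)=\sum_{j} x_j^2\prod_{\ell\ne j}(z-\lambda_\ell)$, a nonzero polynomial of degree at most $n$, and let $f:X\to|\mathcal{O}_{\mathbb{P}^1}(n)|\simeq\mathrm{Sym}^n(\mathbb{P}^1_{\mathbb{C}})\simeq\mathbb{P}^n_{\mathbb{C}}$ send $x$ to the zero divisor (including $\infty$) of the degree-$n$ homogenization of $p_x$. Let $\Delta$ be the discriminant locus (divisors with a multiple point) and $W=f^{-1}(\Delta)_{red}$. $Z_n=\{[x_0:\cdots:x_{n+2}]\in\mathbb{P}^{n+2}_{\mathbb{C}}:\ \sum_{j=0}^{n+2}\lambda_j^r x_j^2=0,\ r=0,1,2,3\}$. *)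

(* Defs.v *)
From HB Require Import structures.
From mathcomp Require Export all_boot all_order all_algebra.
From mathcomp Require Export generic_quotient complex.
From mathcomp Require Export boolp classical_sets reals.
From mathcomp Require Export mpoly.

Set Implicit Arguments.
Unset Strict Implicit.
Unset Printing Implicit Defensive.

Import GRing.Theory.
Local Open Scope classical_set_scope.
Local Open Scope ring_scope.
Local Open Scope quotient_scope.

Section ProjectiveSpace.
Variables (K : fieldType) (N : nat).

Definition nzrow := {v : 'rV[K]_N.+1 | v != 0}.

Definition collinear (u v : nzrow) : bool :=
  `[< exists2 c : K, c != 0 & val u = c *: val v >].

Lemma collinear_refl : reflexive collinear.
Proof. by move=> u; apply/asboolP; exists 1; rewrite ?oner_neq0 ?scale1r. Qed.

Lemma collinear_sym : ssrbool.symmetric collinear.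
Proof.
suff H u v : collinear u v -> collinear v u by move=> u v; apply/idP/idP; apply: H.
move=> /asboolP[c c0 e]; apply/asboolP; exists c^-1; first by rewrite invr_eq0.
by rewrite e scalerA mulVf // scale1r.
Qed.

Lemma collinear_trans : transitive collinear.
Proof.
move=> v u w /asboolP[c c0 e] /asboolP[d d0 e']; apply/asboolP; exists (c * d).
  by rewrite mulf_neq0.
by rewrite e e' scalerA.
Qed.

Definition collinear_equiv :=
  EquivRel collinear collinear_refl collinear_sym collinear_trans.

(* P^N over K, with N+1 homogeneous coordinates indexed by 'I_N.+1. *)
Definition proj := {eq_quot collinear_equiv}.
HB.instance Definition _ := Choice.on proj.
HB.instance Definition _ := EqQuotient.on proj.

(* The point [v_0 : ... : v_N]. *)
Definition mkpt (v : 'rV[K]_N.+1) (v0 : v != 0) : proj := \pi_proj (exist (fun v => v != 0) v v0 : nzrow).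

(* A choice of homogeneous coordinates. *)
Definition coords (x : proj) : 'rV[K]_N.+1 := val (repr x).

Lemma coords_neq0 x : coords x != 0.
Proof. exact: (valP (repr x)). Qed.

Lemma coordsK x : mkpt (coords_neq0 x) = x.
Proof.
rewrite -[RHS]reprK /mkpt; congr (\pi_proj _); exact: val_inj.
Qed.

Lemma mkpt_eqP u v (u0 : u != 0) (v0 : v != 0) :
  mkpt u0 = mkpt v0 <-> exists2 c : K, c != 0 & u = c *: v.
Proof. by split=> [/eqmodP/asboolP|H]; [|apply/eqmodP/asboolP]. Qed.

Lemma coords_mkpt v (v0 : v != 0) :
  exists2 c : K, c != 0 & coords (mkpt v0) = c *: v.
Proof. by apply/(mkpt_eqP (coords_neq0 _) v0); rewrite coordsK. Qed.

Definition zero_locus (S : set {mpoly K[N.+1]}) : set proj :=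
  [set x | forall F, S F -> F.@[coords x 0] = 0].

Definition zariski_closed (A : set proj) : Prop :=
  exists S : set {mpoly K[N.+1]},
    (forall F, S F -> exists d : nat, F \is d.-homog) /\ A = zero_locus S.

Definition zariski_irreducible (A : set proj) : Prop :=
  A !=set0 /\
  forall B C : set proj, zariski_closed B -> zariski_closed C ->
    A `<=` B `|` C -> A `<=` B \/ A `<=` C.

End ProjectiveSpace.

Section BinaryForms.
Variables (K : fieldType) (n : nat).

(* w^n p(z/w), where z = 'X_0 and w = 'X_1; this is meant for size p <= n.+1. *)
Definition homogenize (p : {poly K}) : {mpoly K[2]} :=
  \sum_(i < n.+1) p`_i *: ('X_0 ^+ i * 'X_1 ^+ (n - i)).

(* The form bz - aw vanishing at v = [a : b]; the affine coordinate on P^1 is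
   z/w, so that infinity is [1 : 0]. *)
Definition linear_form (v : 'rV[K]_2) : {mpoly K[2]} :=
  v 0 1 *: 'X_0 - v 0 0 *: 'X_1.

(* Order of vanishing along the zero of L of a nonzero form of degree n. *)
Definition vanishing_order (L F : {mpoly K[2]}) : nat :=
  \max_(k < n.+1 | `[< exists G, F = L ^+ k * G >]) k.

(* |O_{P^1}(n)| is taken to be the projective space of nonzero binary forms of
   degree n, [c_0 : ... : c_n] standing for \sum_i c_i z^i w^(n-i). The point s
   is identified with its zero divisor, written as the function that maps a
   point of P^1 to its multiplicity. *)
Definition zero_divisor (s : proj K n) : proj K 1 -> nat :=
  fun t => vanishing_order (linear_form (coords t))
                           (homogenize (rVpoly (coords s))).

Lemma vanishing_orderZ c d L F : c != 0 -> d != 0 ->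
  vanishing_order (c *: L) (d *: F) = vanishing_order L F.
Proof.
move=> c0 d0; rewrite /vanishing_order; apply: eq_bigl => k.
apply: asbool_equiv_eq; split=> -[G e].
  exists (d^-1 * c ^+ k *: G).
  rewrite -[LHS]scale1r -(mulVf d0) -[LHS]scalerA e exprZn.
  by rewrite -scalerAl -scalerAr scalerA.
exists (d * c ^- k *: G).
rewrite e exprZn -scalerAl -scalerAr !scalerA mulrCA mulfV ?mulr1 //.
by rewrite expf_neq0.
Qed.

Lemma zero_divisorE (c : 'rV[K]_n.+1) (c0 : c != 0) (v : 'rV[K]_2) (v0 : v != 0) :
  zero_divisor (mkpt c0) (mkpt v0) =
  vanishing_order (linear_form v) (homogenize (rVpoly c)).
Proof.
rewrite /zero_divisor.
have [a a0 ->] := coords_mkpt v0; have [b b0 ->] := coords_mkpt c0.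
rewrite -[RHS](vanishing_orderZ _ _ a0 b0); congr (vanishing_order _ _).
  by rewrite /linear_form !mxE scalerBr !scalerA.
rewrite /homogenize linearZ scaler_sumr; apply: eq_bigr => i _.
by rewrite coefZ scalerA.
Qed.

Definition discriminant_locus : set (proj K n) :=
  [set s | exists t, (2 <= zero_divisor s t)%N].

End BinaryForms.

Section Quadrics.
Variables (K : fieldType) (n : nat) (lam : 'I_n.+3 -> K).

(* Cut out by \sum_j lam_j^r x_j^2 for r < m. *)
Definition diag_quadrics (m : nat) : set (proj K n.+2) :=
  [set x | forall r : 'I_m, \sum_j lam j ^+ r * coords x 0 j ^+ 2 = 0].

Definition Xvar : set (proj K n.+2) := diag_quadrics 2.
Definition Zvar : set (proj K n.+2) := diag_quadrics 4.

Definition px (v : 'rV[K]_n.+3) : {poly K} :=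
  \sum_j v 0 j ^+ 2 *: \prod_(l | l != j) ('X - (lam l)%:P).

Lemma diag_quadricsE m v (v0 : v != 0) :
  diag_quadrics m (mkpt v0) <->
  forall r : 'I_m, \sum_j lam j ^+ r * v 0 j ^+ 2 = 0.
Proof.
have [c c0 e] := coords_mkpt v0.
have E r : \sum_j lam j ^+ r * coords (mkpt v0) 0 j ^+ 2 =
           c ^+ 2 * \sum_j lam j ^+ r * v 0 j ^+ 2.
  by rewrite e mulr_sumr; apply: eq_bigr => j _; rewrite !mxE exprMn mulrCA.
split=> H r; move: (H r); rewrite ?E; last by move->; rewrite mulr0.
by move/eqP; rewrite mulf_eq0 expf_eq0 (negPf c0) andbF => /eqP.
Qed.

Lemma size_px (v : 'rV[K]_n.+3) :
  (forall r : 'I_2, \sum_j lam j ^+ r * v 0 j ^+ 2 = 0) ->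
  (size (px v) <= n.+1)%N.
Proof.
move=> H.
pose q j := \prod_(l | l != j) ('X - (lam l)%:P).
pose P r := \sum_j (lam j ^+ r * v 0 j ^+ 2) *: q j.
have PX r : (r < 2)%N -> P r * 'X = P r.+1.
  move=> r2; rewrite /P mulr_suml.
  have E j : (lam j ^+ r * v 0 j ^+ 2) *: q j * 'X =
    (lam j ^+ r * v 0 j ^+ 2) *: \prod_l ('X - (lam l)%:P) +
    (lam j ^+ r.+1 * v 0 j ^+ 2) *: q j.
    rewrite (bigD1 j) //= -/(q j) mulrBl mul_polyC scalerBr scalerA.
    rewrite (exprSr (lam j)) mulrAC subrK -scalerAl; congr (_ *: _).
    exact: mulrC.
  rewrite (eq_bigr _ (fun j _ => E j)) big_split /= -scaler_suml.
  by rewrite (H (Ordinal r2)) scale0r add0r.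
have -> : px v = P 0%N.
  by apply: eq_bigr => j _; rewrite expr0 mul1r.
have sP : (size (P 2) <= n.+3)%N.
  apply: (leq_trans (size_sum _ _ _)); apply/bigmax_leqP => j _.
  apply: (leq_trans (size_scale_leq _ _)); rewrite size_prod => [|l _]; last by rewrite polyXsubC_eq0.
  rewrite (eq_bigr (fun=> 2%N)) => [|l _]; last exact: size_XsubC.
  rewrite sum_nat_const muln2 -addnn subSn ?leq_addr // addnK ltnS.
  by rewrite cardC1 card_ord.
move: sP; rewrite -PX // -PX //.
have [->|P0] := eqVneq (P 0%N) 0; first by rewrite size_poly0.
by rewrite !size_mulX ?mulf_neq0 ?polyX_eq0.
Qed.

Hypothesis lam_inj : injective lam.

Lemma px_neq0 v : v != 0 -> px v != 0.
Proof.
move=> /rV0Pn[j vj]; apply/eqP => /(congr1 (fun p => p.[lam j])).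
rewrite horner0 /px horner_sum (bigD1 j) //= [X in _ + X]big1 => [|i ij].
  rewrite addr0 hornerZ horner_prod => /eqP.
  rewrite mulf_eq0 expf_eq0 (negPf vj) andbF /=.
  apply/negP/prodf_neq0 => l lj; rewrite hornerXsubC subr_eq0.
  by apply: contraNneq lj => /lam_inj ->.
rewrite hornerZ horner_prod (bigD1 j) 1?eq_sym //=.
by rewrite hornerXsubC subrr mul0r mulr0.
Qed.

Lemma px_row_neq0 (x : Xvar) :
  poly_rV (px (coords (val x))) != 0 :> 'rV[K]_n.+1.
Proof.
apply/eqP => /(congr1 rVpoly); rewrite linear0 poly_rV_K.
  exact/eqP/px_neq0/coords_neq0.
exact: size_px (set_valP x).
Qed.

Definition f_map (x : Xvar) : proj K n := mkpt (px_row_neq0 x).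

(* The reduced closed subscheme f^-1(Delta)_red, as its set of K-points. *)
Definition W : set (proj K n.+2) :=
  val @` (f_map @^-1` @discriminant_locus K n).

Definition nu_row (v : 'rV[K]_2) (x : 'rV[K]_n.+3) : 'rV[K]_n.+3 :=
  \row_j ((v 0 1 * lam j - v 0 0) * x 0 j).

Lemma nu_row_neq0 (v : 'rV[K]_2) (x : 'rV[K]_n.+3) : v != 0 -> x != 0 -> \sum_j x 0 j ^+ 2 = 0 ->
  nu_row v x != 0.
Proof.
move=> v0 /rV0Pn[i xi] sx; apply/eqP => /rowP E.
have Z j : x 0 j != 0 -> v 0 1 * lam j = v 0 0.
  move=> xj; move: (E j); rewrite !mxE => /eqP.
  by rewrite mulf_eq0 (negPf xj) orbF subr_eq0 => /eqP.
have [b0|b0] := eqVneq (v 0 1) 0.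
  move: (Z i xi); rewrite b0 mul0r => a0; case/eqP: v0; apply/rowP=> -[[|[|//]] kP];
    rewrite mxE; [rewrite [RHS]a0|rewrite -[RHS]b0]; congr (v _ _); exact: val_inj.
have U j : j != i -> x 0 j ^+ 2 = 0.
  move=> ji; apply/eqP; rewrite expf_eq0 /=; apply: contraNT ji => xj.
  by apply/eqP/lam_inj/(mulfI b0); rewrite !Z.
move/eqP: sx; rewrite (bigD1 i) //= big1 // addr0 expf_eq0 /=.
exact/negP.
Qed.

Lemma Zvar_sum0 x : Zvar x -> \sum_j coords x 0 j ^+ 2 = 0.
Proof.
move=> Zx; rewrite -[RHS](Zx 0); apply: eq_bigr => j _.
by rewrite expr0 mul1r.
Qed.

Definition nu (y : proj K 1 * Zvar) : proj K n.+2 :=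
  mkpt (nu_row_neq0 (coords_neq0 y.1) (coords_neq0 (val y.2))
                    (Zvar_sum0 (set_valP y.2))).

(* f_map and nu do not depend on the choice of coordinates. *)
Lemma f_mapE (x : Xvar) v (v0 : v != 0)
    (p0 : poly_rV (px v) != 0 :> 'rV[K]_n.+1) :
  val x = mkpt v0 -> f_map x = mkpt p0.
Proof.
move=> xv; rewrite /f_map; apply/mkpt_eqP.
rewrite xv; have [c c0 ->] := coords_mkpt v0.
exists (c ^+ 2); first by rewrite expf_neq0.
rewrite -linearZ; congr poly_rV; rewrite /px scaler_sumr.
by apply: eq_bigr => j _; rewrite !mxE exprMn scalerA.
Qed.

Lemma nuE (z : Zvar) v (v0 : v != 0) x (x0 : x != 0) (w0 : nu_row v x != 0) :
  val z = mkpt x0 -> nu (mkpt v0, z) = mkpt w0.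
Proof.
move=> zx; rewrite /nu /=; apply/mkpt_eqP.
rewrite zx; have [c c0 ->] := coords_mkpt x0; have [d d0 ->] := coords_mkpt v0.
exists (d * c); first by rewrite mulf_neq0.
by apply/rowP => j; rewrite !mxE -mulrA -mulrBr mulrACA.
Qed.

End Quadrics.

(* Main.v *)
(* Write Q = \prod_l (z - lam_l) and L(c) = \sum_j c_j Q / (z - lam_j), so that
   p_x = L(x^2). Everything about the image rests on the identity
     (b z - a) L(c) = b (\sum_j c_j) Q + L((b lam - a) c).
   It shows that the power sums \sum_j lam_j^r c_j vanish for r < k exactly when
   deg L(c) drops by k, and that p_x = (b z - a)^2 p_y when x = (b lam - a) y
   with y in Z_n. Conversely, when (b z - a)^2 divides p_x, dividing x_j by
   b lam_j - a gives y; if b lam_i = a for some i, then x_i = 0 and y_i is free,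
   and is chosen to make \sum_j y_j^2 vanish.

   For irreducibility, let forms F, G be such that F G vanishes on W, while
   F(p) <> 0 and G(q) <> 0 for some p, q in W. The points p, q come from
   (v, y), (v', y'), which are joined inside P^1 x Z_n by moving v linearly to v'
   and letting x_j^2 = f_j := e_j (a - r_j(t)). Here e_j = 1 / Q'(lam_j), so that
   (e_j) and (lam_j e_j) satisfy the equations of Z_n when n >= 3, and the r_j
   are distinct quadratic polynomials. A nonempty product of the f_j is not a
   square in K(t, a), so adjoining the square roots of all the f_j gives a field
   in which their squarefree products are linearly independent (Kummer theory).
   The generic point has coordinates in that field, so F or G vanishes there,
   hence along the whole surface, contradicting the choice of p and q. *)
Require Import Defs.
From mathcomp Require Import all_field fraction ring zify.

Set Implicit Arguments.
Unset Strict Implicit.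
Unset Printing Implicit Defensive.

Import GRing.Theory Num.Theory.
Local Open Scope classical_set_scope.
Local Open Scope ring_scope.

(** * Weighted sums of node polynomials *)

Section LagrangeSums.
Variables (K : fieldType) (N : nat) (lam : 'I_N.+1 -> K).
Implicit Types c : 'I_N.+1 -> K.

Let Q := \prod_l ('X - (lam l)%:P).
Let q j := \prod_(l | l != j) ('X - (lam l)%:P).

Definition lagrange_sum c : {poly K} :=
  \sum_j c j *: \prod_(l | l != j) ('X - (lam l)%:P).

Lemma size_node_prod j : size (q j) = N.+1.
Proof.
rewrite -[q j]big_filter size_prod_XsubC size_filter -sum1_count sum1_card.
by rewrite cardC1 card_ord.
Qed.

Lemma size_lagrange_sum_le c : (size (lagrange_sum c) <= N.+1)%N.
Proof.
apply: (leq_trans (size_sum _ _ _)); apply/bigmax_leqP => j _.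
by apply: (leq_trans (size_scale_leq _ _)); rewrite size_node_prod.
Qed.

Lemma lagrange_sum_coefN c : (lagrange_sum c)`_N = \sum_j c j.
Proof.
rewrite coef_sum; apply: eq_bigr => j _; rewrite coefZ.
suff -> : (q j)`_N = 1 by rewrite mulr1.
have /eqP := monic_prod_XsubC (index_enum _) (fun l => l != j) lam.
by rewrite lead_coefE -/(q j) size_node_prod.
Qed.

Lemma eq_lagrange_sum c c' : c =1 c' -> lagrange_sum c = lagrange_sum c'.
Proof. by move=> e; apply: eq_bigr => j _; rewrite e. Qed.

(** Termwise, [b z - a = b (z - lam_j) + (b lam_j - a)], and [z - lam_j] completes the [j]-th node
    product to [Q]. *)
Lemma linear_lagrange_sum b a c :
  (b *: 'X - a%:P) * lagrange_sum c =
  (b * \sum_j c j) *: Q + lagrange_sum (fun j => (b * lam j - a) * c j).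
Proof.
rewrite /lagrange_sum mulr_sumr mulr_sumr scaler_suml -big_split.
apply: eq_bigr => j _; have -> : Q = ('X - (lam j)%:P) * q j by exact: bigD1.
by rewrite -/(q j) -!mul_polyC !polyCM !polyCB !polyCM /=; ring.
Qed.

Lemma horner_lagrange_sum c i :
  (lagrange_sum c).[lam i] = c i * (q i).[lam i].
Proof.
rewrite horner_sum (bigD1 i) //= [X in _ + X]big1 => [|j ji].
  by rewrite addr0 hornerZ.
by rewrite hornerZ horner_prod (bigD1 i) 1?eq_sym //= hornerXsubC subrr mul0r mulr0.
Qed.

Lemma node_prod_neq0 i : injective lam -> (q i).[lam i] != 0.
Proof.
move=> lam_inj; rewrite horner_prod; apply/prodf_neq0 => l li.
by rewrite hornerXsubC subr_eq0; apply: contraNneq li => /lam_inj ->.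
Qed.

(** Induction on [k]: the coefficient of degree [N] is the sum of the [c_j]; once it vanishes,
    multiplying by ['X] replaces [c_j] by [lam_j c_j], which shifts the power sums by one. *)
Lemma size_lagrange_sum k c : (k <= N.+1)%N ->
  (size (lagrange_sum c) <= N.+1 - k)%N <->
  forall r, (r < k)%N -> \sum_j lam j ^+ r * c j = 0.
Proof.
elim: k c => [|k IHk] c kN.
  by split=> // _; rewrite subn0 size_lagrange_sum_le.
have E : \sum_j c j = 0 ->
    lagrange_sum c * 'X = lagrange_sum (fun j => lam j * c j).
  move=> c0; have := linear_lagrange_sum 1 0 c.
  rewrite c0 mulr0 scale0r add0r scale1r polyC0 subr0 mulrC => ->.
  by apply: eq_lagrange_sum => j; rewrite mul1r subr0.
have S : \sum_j c j = 0 ->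
    (size (lagrange_sum c) <= N.+1 - k.+1)%N =
    (size (lagrange_sum (fun j => lam j * c j)%R) <= N.+1 - k)%N.
  move=> /E <-; have [->|L0] := eqVneq (lagrange_sum c) 0.
    by rewrite mul0r size_poly0.
  by rewrite size_mulX // subSS subSn.
have mS r : \sum_j lam j ^+ r * (lam j * c j) = \sum_j lam j ^+ r.+1 * c j.
  by apply: eq_bigr => j _; rewrite exprSr mulrA.
have m0 : \sum_j c j = \sum_j lam j ^+ 0 * c j.
  by apply: eq_bigr => j _; rewrite expr0 mul1r.
split=> [sL|mc].
  have c0 : \sum_j c j = 0.
    by rewrite -lagrange_sum_coefN nth_default // (leq_trans sL) // subSS leq_subr.
  case=> [_|r rk]; first by rewrite -m0.
  by rewrite -mS; apply: (IHk _ (ltnW kN)).1 => //; rewrite -S.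
have c0 : \sum_j c j = 0 by rewrite m0 mc.
by rewrite S // IHk ?(ltnW kN) // => r rk; rewrite mS mc.
Qed.

End LagrangeSums.

(** * Binary forms: double factors and dehomogenization *)

Section Homogenize.
Variable K : fieldType.

Lemma homogenize_mul_linear n (v : 'rV[K]_2) (p : {poly K}) :
  (size p <= n.+1)%N ->
  homogenize n.+1 ((v 0 1 *: 'X - (v 0 0)%:P) * p) =
  linear_form v * homogenize n p.
Proof.
move=> sp; rewrite /homogenize /linear_form mulrBl [RHS]mulrBl !mulr_sumr.
under eq_bigr do rewrite coefB scalerBl.
rewrite big_split /= sumrN; congr (_ - _).
  rewrite big_ord_recl -scalerAl coefZ coefXM mulr0 scale0r add0r.
  apply: eq_bigr => i _; rewrite coefZ coefXM /= /bump /= add1n subSS.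
  by rewrite -scalerAr -scalerAl scalerA mulrC exprS -mulrA.
rewrite big_ord_recr /= coefCM nth_default // mulr0 scale0r addr0.
apply: eq_bigr => i _; rewrite coefCM subSn -1?ltnS //.
rewrite -scalerAr -scalerAl scalerA mulrC exprS; congr (_ *: _); ring.
Qed.

(** The maximum defining the order runs over [k <= n], so [n >= 2] lets the exponent 2 take part in
    it. *)
Lemma vanishing_order_ge2 n (L F : {mpoly K[2]}) : (2 <= n)%N ->
  (2 <= vanishing_order n L F)%N <-> exists G, F = L ^+ 2 * G.
Proof.
move=> n2; split=> [|FG].
  apply: contraPP => nG; apply/negP; rewrite -ltnNge ltnS.
  apply/bigmax_leqP => k /asboolP[G e]; rewrite leqNgt; apply/negP => k2.
  by apply: nG; exists (L ^+ (k - 2) * G); rewrite mulrA -exprD subnKC.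
have h : (2 < n.+1)%N by [].
by apply: (leq_bigmax_cond (Ordinal h)); apply/asboolP.
Qed.

Lemma mmap_homogenize_X n (p : {poly K}) : (size p <= n.+1)%N ->
  mmap (@polyC K) (fun i : 'I_2 => if i == 0 then 'X else 1) (homogenize n p) = p.
Proof.
move=> sp; rewrite /homogenize raddf_sum /= -[RHS](coefK p).
rewrite [RHS](poly_def) (big_ord_widen n.+1 (fun i => p`_i *: 'X^i)) //.
rewrite [RHS]big_mkcond; apply: eq_bigr => i _.
rewrite mmapZ rmorphM !rmorphXn /= !mmapX !mmap1U /= expr1n mulr1 mul_polyC.
by case: ltnP => // ?; rewrite nth_default // scale0r.
Qed.

(** Setting [z = 1] is the chart at infinity, where the coefficients of [p] appear in reverse
    order. *)
Lemma coef_mmap_homogenize n (p : {poly K}) r : (r <= n)%N ->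
  (mmap (@polyC K) (fun i : 'I_2 => if i == 0 then 1 else 'X)
    (homogenize n p))`_r = p`_(n - r).
Proof.
move=> rn; rewrite /homogenize raddf_sum /= coef_sum.
have h : (n - r < n.+1)%N by rewrite ltnS leq_subr.
rewrite (bigD1 (Ordinal h)) //= big1 ?addr0 => [|i /eqP ir];
  rewrite mmapZ rmorphM !rmorphXn /= !mmapX !mmap1U /= expr1n mul1r coefCM coefXn.
  by rewrite subKn // eqxx mulr1.
case: eqP => [er|]; last by rewrite mulr0.
by case: ir; apply: val_inj; rewrite /= er subKn // -ltnS.
Qed.

End Homogenize.

(** * Double roots of Lagrange sums *)

Section DoubleRoots.
Variables (K : numClosedFieldType) (N : nat) (lam : 'I_N.+1 -> K).
Hypothesis lam_inj : injective lam.

Lemma double_root_sums (a b : K) (c : 'I_N.+1 -> K) (h : {poly K}) : b != 0 ->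
  (b *: 'X - a%:P) ^+ 2 * h =
    lagrange_sum lam (fun j => (b * lam j - a) * ((b * lam j - a) * c j)) ->
  (forall j, b * lam j - a != 0) \/ \sum_j c j = 0 ->
  \sum_j c j = 0 /\ \sum_j (b * lam j - a) * c j = 0.
Proof.
move=> b0 eh hd.
set Q := \prod_l ('X - (lam l)%:P).
have l0 : b *: 'X - a%:P != 0.
  apply/eqP => /(congr1 (fun p : {poly K} => p`_1)) /eqP.
  by rewrite coefB coefZ coefX coefC coef0 subr0 mulr1 (negPf b0).
have lt : (b *: 'X - a%:P).[a / b] = 0.
  by rewrite hornerD hornerN hornerZ hornerX hornerC mulrCA divff // mulr1 subrr.
have E1 := linear_lagrange_sum lam b a c.
have E2 := linear_lagrange_sum lam b a (fun j => (b * lam j - a) * c j).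
set l := b *: 'X - a%:P in eh l0 lt E1 E2.
rewrite -/Q in E1 E2.
set m0 := \sum_j c j in hd E1 *; set m1 := \sum_j _ in E2 *.
pose g := lagrange_sum lam c - h.
(* The linear identity applied twice. If [a / b] is no node, evaluating there kills [m1], and after
   cancelling [l] also [m0]; if it is a node, [m0 = 0] is assumed and [Q] has only a simple zero,
   which kills [m1]. *)
have E : l ^+ 2 * g = l * ((b * m0) *: Q) + (b * m1) *: Q.
  by rewrite mulrBr eh expr2 -mulrA E1 mulrDr E2; ring.
have A : (forall j, b * lam j - a != 0) -> m0 = 0 /\ m1 = 0.
  move=> d0; have Qt : Q.[a / b] != 0.
    rewrite horner_prod; apply/prodf_neq0 => j _; rewrite hornerXsubC.
    apply: contraNneq (d0 j) => e; apply/eqP.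
    have -> : lam j = a / b by apply/esym/eqP; rewrite -subr_eq0 e.
    by rewrite mulrCA divff // mulr1 subrr.
  have zQ (u : K) : (b * u) * Q.[a / b] = 0 -> u = 0.
    by move/eqP; rewrite mulf_eq0 (negPf Qt) mulf_eq0 (negPf b0) orbF => /eqP.
  have m10 : m1 = 0.
    apply: (zQ); move: (congr1 (fun p => p.[a / b]) E).
    by rewrite hornerD !hornerM lt !mul0r add0r hornerZ => <-.
  split=> //; apply: zQ; move: E; rewrite m10 mulr0 scale0r addr0 expr2 -mulrA.
  move=> /(mulfI l0)/(congr1 (fun p => p.[a / b])).
  by rewrite hornerM lt mul0r hornerZ => <-.
have [/existsP[i /eqP di]|/existsPn d0] := boolP [exists i, b * lam i - a == 0];
  last exact: A.
case: hd => [/(_ i)|m00]; first by rewrite di eqxx.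
split=> //; move: E; rewrite m00 mulr0 scale0r mulr0 add0r.
have -> : Q = ('X - (lam i)%:P) * \prod_(l | l != i) ('X - (lam l)%:P).
  exact: bigD1.
have -> : l = b *: ('X - (lam i)%:P).
  rewrite scalerBr /l; congr (_ - _); rewrite -mul_polyC -polyCM; congr _%:P.
  by apply/esym/eqP; rewrite -subr_eq0 di.
move: (node_prod_neq0 i lam_inj); set q := \prod_(l | _) _ => qi e.
have X0 : 'X - (lam i)%:P != 0 by rewrite polyXsubC_eq0.
have : ('X - (lam i)%:P) * ((b * m1) *: q) =
  ('X - (lam i)%:P) * ((b * b) *: (('X - (lam i)%:P) * g)).
  by rewrite -scalerAr -e -!mul_polyC polyCM; ring.
move=> /(mulfI X0)/(congr1 (fun p => p.[lam i])) /eqP.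
rewrite !hornerZ hornerM hornerXsubC subrr mul0r mulr0.
by rewrite !mulf_eq0 (negPf b0) (negPf qi) orbF => /eqP.
Qed.

Lemma double_root_lift (a b : K) (x : 'I_N.+1 -> K) (h : {poly K}) : b != 0 ->
  (forall r, (r < 2)%N -> \sum_j lam j ^+ r * x j ^+ 2 = 0) ->
  (b *: 'X - a%:P) ^+ 2 * h = lagrange_sum lam (fun j => x j ^+ 2) ->
  exists2 y : 'I_N.+1 -> K,
    forall j, x j = (b * lam j - a) * y j &
    forall r, (r < 4)%N -> \sum_j lam j ^+ r * y j ^+ 2 = 0.
Proof.
move=> b0 mx eh.
have [y xy hd] : exists2 y : 'I_N.+1 -> K, forall j, x j = (b * lam j - a) * y j
    & (forall j, b * lam j - a != 0) \/ \sum_j y j ^+ 2 = 0.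
  have [/existsP[i /eqP di]|/existsPn d0] := boolP [exists i, b * lam i - a == 0].
    pose y0 j := x j / (b * lam j - a).
    pose s := \sum_(j | j != i) y0 j ^+ 2.
    exists (fun j => if j == i then sqrtC (- s) else y0 j) => [j|].
      case: eqP => [->|/eqP ji]; last first.
        rewrite mulrCA divff ?mulr1 //; apply: contraNneq ji => dj.
        by apply/eqP/lam_inj/(mulfI b0)/(@addIr _ (- a)); rewrite dj di.
      (* At the node [lam i] the left side of [eh] vanishes, while the Lagrange sum is a nonzero
         multiple of [x i ^+ 2]; hence [x i = 0]. *)
      rewrite di mul0r; move: (congr1 (fun p => p.[lam i]) eh).
      rewrite horner_lagrange_sum hornerM horner_exp.
      rewrite hornerD hornerN hornerZ hornerX hornerC di expr0n mul0r => /esym/eqP.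
      by rewrite mulf_eq0 (negPf (node_prod_neq0 i lam_inj)) orbF expf_eq0 /= => /eqP.
    right; rewrite (bigD1 i) //= eqxx sqrtCK; apply/eqP.
    by rewrite addrC subr_eq0 /s; apply/eqP; apply: eq_bigr => j /negPf ->.
  exists (fun j => x j / (b * lam j - a)); last by left.
  by move=> j; rewrite mulrCA divff ?mulr1.
exists y => //.
have [|m0 m1] := double_root_sums (a := a) (c := fun j => y j ^+ 2) (h := h) b0 _ hd.
  rewrite eh; apply: eq_lagrange_sum => j; rewrite xy; ring.
pose m r := \sum_j lam j ^+ r * y j ^+ 2.
have n0 : m 0%N = 0 by rewrite -[RHS]m0; apply: eq_bigr => j _; rewrite mul1r.
have zb u : b * u = 0 -> u = 0.
  by move/eqP; rewrite mulf_eq0 (negPf b0) => /eqP.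
have n1 : m 1%N = 0.
  apply: (zb); rewrite -[RHS]m1; transitivity (b * m 1%N - a * m 0%N).
    by rewrite n0 mulr0 subr0.
  rewrite !mulr_sumr -sumrB.
  by apply: eq_bigr => j _; ring.
(* Expanding the equations for [x] gives a recurrence with leading coefficient [b ^+ 2], which
   carries the vanishing of [m 0], [m 1] to [m 2], [m 3]. *)
have rec r : (r < 2)%N -> b ^+ 2 * m r.+2 - (a * b *+ 2) * m r.+1 + a ^+ 2 * m r = 0.
  move=> /mx <-; rewrite !mulr_sumr -sumrB -big_split /=.
  by apply: eq_bigr => j _; rewrite xy !exprS; ring.
have n2 : m 2 = 0.
  do 2!apply: (zb); have := rec 0%N isT.
  by rewrite n0 n1 !mulr0 subr0 addr0 expr2 -mulrA.
have n3 : m 3 = 0.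
  do 2!apply: (zb); have := rec 1%N isT.
  by rewrite n1 n2 !mulr0 subr0 addr0 expr2 -mulrA.
by case=> [|[|[|[|r]]]].
Qed.

End DoubleRoots.

(** * Double zeros of [p_x] and points of [Z_n] *)

Section DoubleZeros.
Variables (K : numClosedFieldType) (n : nat) (lam : 'I_n.+3 -> K).
Hypotheses (n_ge2 : (2 <= n)%N) (lam_inj : injective lam).

Lemma nu_row_sums (v : 'rV[K]_2) (y : 'rV[K]_n.+3) k :
  (forall r : 'I_k.+2, \sum_j lam j ^+ r * y 0 j ^+ 2 = 0) ->
  forall r : 'I_k, \sum_j lam j ^+ r * nu_row lam v y 0 j ^+ 2 = 0.
Proof.
move=> my r; pose m s := \sum_j lam j ^+ s * y 0 j ^+ 2.
have mz s : (s < k.+2)%N -> m s = 0 by move=> h; exact: (my (Ordinal h)).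
have rk := ltn_ord r.
transitivity (v 0 1 ^+ 2 * m r.+2 - (v 0 0 * v 0 1 *+ 2) * m r.+1
               + v 0 0 ^+ 2 * m r).
  rewrite !mulr_sumr -sumrB -big_split /=.
  by apply: eq_bigr => j _; rewrite mxE !exprS; ring.
by rewrite !mz ?mulr0 ?subr0 ?addr0 //; lia.
Qed.

Lemma double_zeroP (v : 'rV[K]_2) (x : 'rV[K]_n.+3) : v != 0 ->
  (forall r : 'I_2, \sum_j lam j ^+ r * x 0 j ^+ 2 = 0) ->
  (exists G, homogenize n (px lam x) = linear_form v ^+ 2 * G) <->
  exists2 y : 'rV[K]_n.+3,
    forall r : 'I_4, \sum_j lam j ^+ r * y 0 j ^+ 2 = 0 & x = nu_row lam v y.
Proof.
move=> v0 mx.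
have mx' r : (r < 2)%N -> \sum_j lam j ^+ r * x 0 j ^+ 2 = 0.
  by move=> h; exact: (mx (Ordinal h)).
have pxE : px lam x = lagrange_sum lam (fun j => x 0 j ^+ 2) by [].
split=> [[G eG]|[y my xy]]; last first.
  have my' r : (r < 4)%N -> \sum_j lam j ^+ r * y 0 j ^+ 2 = 0.
    by move=> h; exact: (my (Ordinal h)).
  set l := v 0 1 *: 'X - (v 0 0)%:P.
  set g := lagrange_sum lam (fun j => y 0 j ^+ 2).
  have m0 : \sum_j y 0 j ^+ 2 = 0.
    by rewrite -[RHS](my' 0%N) //; apply: eq_bigr => j _; rewrite mul1r.
  have m1 : \sum_j (v 0 1 * lam j - v 0 0) * y 0 j ^+ 2 = 0.
    transitivity (v 0 1 * (\sum_j lam j ^+ 1 * y 0 j ^+ 2)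
                  - v 0 0 * \sum_j y 0 j ^+ 2).
      by rewrite !mulr_sumr -sumrB; apply: eq_bigr => j _; ring.
    by rewrite my' // m0 !mulr0 subr0.
  have e : px lam x = l * (l * g).
    rewrite linear_lagrange_sum m0 mulr0 scale0r add0r.
    rewrite linear_lagrange_sum m1 mulr0 scale0r add0r.
    by apply: eq_lagrange_sum => j; rewrite xy mxE; ring.
  (* The four equations for [y] leave [g] of degree at most [n - 2], as needed to homogenize it in
     that degree. *)
  have sg : (size g <= n.-1)%N.
    have := (size_lagrange_sum lam (k := 4) (fun j => y 0 j ^+ 2) _).2 my'.
    by rewrite -/g subSS; lia.
  have sl : (size l <= 2)%N.
    rewrite (leq_trans (size_polyD _ _)) // geq_max size_polyN.
    by rewrite (leq_trans (size_scale_leq _ _)) ?size_polyX // (leq_trans (size_polyC_leq1 _)).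
  exists (homogenize n.-2 g); rewrite e.
  case: n n_ge2 sg sl {e} => [|[|n']] //= _ sg sl.
  have slg : (size (l * g)%R <= n'.+2)%N.
    by rewrite (leq_trans (size_polyMleq _ _)) // -subn1 leq_subLR (leq_add sl sg).
  by rewrite homogenize_mul_linear // homogenize_mul_linear // mulrA.
have sp : (size (px lam x) <= n.+1)%N by apply: size_px.
(* At a finite point, setting [w = 1] turns the factorization of forms into one of polynomials. *)
have [b0|b0] := eqVneq (v 0 1) 0; last first.
  move: (congr1 (mmap (@polyC K) (fun i : 'I_2 => if i == 0 then 'X else 1)) eG).
  rewrite mmap_homogenize_X // rmorphM rmorphXn /= /linear_form.
  rewrite rmorphB /= !mmapZ !mmapX !mmap1U /= mul_polyC mulr1 => /esym eh.
  have [y xy my] := double_root_lift lam_inj b0 mx' eh.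
  exists (\row_j y j).
    by move=> r; rewrite -[RHS](my r) //; apply: eq_bigr => j _; rewrite mxE.
  by apply/rowP => j; rewrite !mxE.
have a0 : v 0 0 != 0.
  apply: contraNneq v0 => a0; apply/eqP/rowP => -[[|[|//]] i]; rewrite mxE.
    by rewrite -[RHS]a0; congr (v _ _); apply: val_inj.
  by rewrite -[RHS]b0; congr (v _ _); apply: val_inj.
(* At infinity the linear form is a multiple of [w], so the two top coefficients of [p_x] vanish.
   Hence [x] itself satisfies all four equations, and [nu_row] only rescales by [- v 0 0]. *)
have pr r : (r < 2)%N -> (px lam x)`_(n - r) = 0.
  move=> r2; rewrite -coef_mmap_homogenize; last by lia.
  rewrite eG rmorphM rmorphXn /= /linear_form rmorphB /= !mmapZ !mmapX !mmap1U /=.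
  rewrite b0 mul0r sub0r sqrrN exprMn -mulrA mulrCA coefXnM; by rewrite r2.
have sp' : (size (px lam x) <= n.+3 - 4)%N.
  apply/leq_sizeP => i hi; have [ni|ni] := ltnP n i.
    by rewrite nth_default // (leq_trans sp).
  have -> : i = (n - (n - i))%N by rewrite subKn.
  by apply: pr; lia.
exists (- (v 0 0)^-1 *: x).
  move=> r; rewrite -[RHS](mulr0 ((v 0 0)^-1 ^+ 2)).
  rewrite -[X in _ * X]((size_lagrange_sum lam (fun j => x 0 j ^+ 2) _).1 sp' r _) //; last by lia.
  by rewrite mulr_sumr; apply: eq_bigr => j _; rewrite !mxE; ring.
by apply/rowP => j; rewrite !mxE b0 mul0r sub0r mulrA mulrNN divff // mul1r.
Qed.

End DoubleZeros.

(** * The image of nu *)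

Section ImageOfNu.
Variables (K : numClosedFieldType) (n : nat) (lam : 'I_n.+3 -> K).
Hypotheses (n_ge2 : (2 <= n)%N) (lam_inj : injective lam).

Lemma nu_rowZl c (v : 'rV[K]_2) (y : 'rV[K]_n.+3) :
  nu_row lam (c *: v) y = c *: nu_row lam v y.
Proof. by apply/rowP => j; rewrite !mxE; ring. Qed.

Lemma nu_row_eq0l (y : 'rV[K]_n.+3) : nu_row lam 0 y = 0.
Proof. by apply/rowP => j; rewrite !mxE; ring. Qed.

Lemma nu_row_eq0r (v : 'rV[K]_2) : nu_row lam v 0 = 0.
Proof. by apply/rowP => j; rewrite !mxE; ring. Qed.

(** This is the same description in coordinates as the one in [WP]. Neither [v] nor [y] is asked to
    be nonzero, because [coords x] is. *)
Lemma range_nuP (x : proj K n.+2) :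
  range (nu lam_inj) x <-> exists v, exists2 y : 'rV[K]_n.+3,
    forall r : 'I_4, \sum_j lam j ^+ r * y 0 j ^+ 2 = 0 &
    coords x = nu_row lam v y.
Proof.
split=> [[[t z] _ <-]|[v [y my e]]].
  rewrite /nu; have [c c0 ->] := coords_mkpt (nu_row_neq0 lam_inj
    (coords_neq0 t) (coords_neq0 (val z)) (Zvar_sum0 (set_valP z))).
  exists (c *: coords t), (coords (val z)); first exact: set_valP z.
  by rewrite nu_rowZl.
have w0 := coords_neq0 x; rewrite e in w0.
have v0 : v != 0 by apply: contraNneq w0 => ->; rewrite nu_row_eq0l.
have y0 : y != 0 by apply: contraNneq w0 => ->; rewrite nu_row_eq0r.
have Zy : Zvar lam (mkpt y0) by apply/diag_quadricsE.
exists (mkpt v0, exist _ (mkpt y0) (mem_set Zy)) => //.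
rewrite (nuE lam_inj v0 (x0 := y0) w0) // -[RHS]coordsK.
by apply/mkpt_eqP; exists 1; rewrite ?oner_neq0 // scale1r e.
Qed.

Lemma WP (x : proj K n.+2) :
  W lam_inj x <-> exists v, exists2 y : 'rV[K]_n.+3,
    forall r : 'I_4, \sum_j lam j ^+ r * y 0 j ^+ 2 = 0 &
    coords x = nu_row lam v y.
Proof.
have fmapE (z : Xvar lam) (v : 'rV[K]_2) (v0 : v != 0) :
    (2 <= zero_divisor (f_map lam_inj z) (mkpt v0))%N <->
    exists2 y : 'rV[K]_n.+3,
      forall r : 'I_4, \sum_j lam j ^+ r * y 0 j ^+ 2 = 0 &
      coords (val z) = nu_row lam v y.
  rewrite zero_divisorE poly_rV_K; last exact: size_px (set_valP z).
  rewrite vanishing_order_ge2 //; exact: double_zeroP (set_valP z).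
split=> [[z [t ht] <-]|[v [y my e]]].
  by exists (coords t); apply/(fmapE _ _ (coords_neq0 t)); rewrite coordsK.
have v0 : v != 0.
  by apply: contraNneq (coords_neq0 x) => v0; rewrite e v0 nu_row_eq0l.
have Xx : Xvar lam x by rewrite /Xvar /diag_quadrics /= e; apply: nu_row_sums.
exists (exist _ x (mem_set Xx)) => //.
by exists (mkpt v0); apply/fmapE; exists y.
Qed.

End ImageOfNu.

(** * Adjoining square roots *)

Section SquareRootTowers.

Lemma sum_powerset_setD1 (V : nmodType) (I : finType) (T : {set I}) i
    (F : {set I} -> V) : i \in T ->
  \sum_(S in powerset T) F S =
  \sum_(S in powerset (T :\ i)) (F S + F (i |: S)).
Proof.
move=> iT; rewrite big_split (bigID [pred S : {set I} | i \in S]) /= addrC.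
congr (_ + _).
  by apply: eq_bigl => S; rewrite !powersetE subsetD1.
rewrite (reindex_onto (fun S => i |: S) (fun S => S :\ i)) /=; last first.
  by move=> S /andP[_ iS]; rewrite finset.setD1K.
apply: eq_bigl => S; rewrite !powersetE subsetD1 finset.subUset finset.sub1set iT finset.setU11 andbT /=.
congr (_ && _); apply/eqP/idP => [<-|iS]; first by rewrite finset.setD11.
by rewrite finset.setU1K.
Qed.

(** For [i] in [T] the sum has the form [A + B x_i]; both signs of [x_i] are allowed, so [A] and [B]
    vanish separately, and induction on [T] applies to each. *)
Lemma sign_independence (K : fieldType) (I : finType) (x : I -> K) :
  2 != 0 :> K -> (forall i, x i != 0) ->
  forall (T : {set I}) (c : {set I} -> K),
  (forall x' : I -> K, (forall i, x' i ^+ 2 = x i ^+ 2) ->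
    \sum_(S in powerset T) c S * \prod_(j in S) x' j = 0) ->
  forall S : {set I}, S \subset T -> c S = 0.
Proof.
move=> two0 x0 T; move: {2}#|T| (erefl #|T|) => k.
elim: k T => [|k IHk] T cT c hc S ST.
  move/eqP: cT; rewrite cards_eq0 => /eqP T0; rewrite T0 in hc ST.
  move: ST; rewrite finset.subset0 => /eqP ->.
  by have := hc x (fun=> erefl); rewrite powerset0 big_set1 big_set0 mulr1.
have /card_gt0P[i iT] : (0 < #|T|)%N by rewrite cT.
have cT' : #|T :\ i| = k by move: cT; rewrite (cardsD1 i) iT => -[].
have key e : e ^+ 2 = x i ^+ 2 ->
    forall S' : {set I}, S' \subset T :\ i -> c S' + c (i |: S') * e = 0.
  move=> he; apply: (IHk _ cT') => x' hx'.
  pose x'' j := if j == i then e else x' j.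
  have /hc : forall j, x'' j ^+ 2 = x j ^+ 2.
    by move=> j; rewrite /x''; case: eqP => [->|].
  rewrite (sum_powerset_setD1 _ iT) => h; rewrite -[RHS]h; apply: eq_bigr => S'.
  rewrite powersetE subsetD1 => /andP[_ iS'].
  rewrite big_setU1 //= {2}/x'' eqxx mulrDl mulrA.
  have -> : \prod_(j in S') x'' j = \prod_(j in S') x' j.
    apply: eq_bigr => j jS'; rewrite /x''; case: eqP => // ji.
    by rewrite -ji jS' in iS'.
  by [].
have both (S' : {set I}) : S' \subset T :\ i -> c S' = 0 /\ c (i |: S') = 0.
  move=> hS'; have e1 := key _ erefl _ hS'.
  have e2 := key _ (sqrrN _) _ hS'; rewrite mulrN in e2.
  have c0 : c S' = 0.
    apply/eqP; move: (congr2 +%R e1 e2) => /eqP; rewrite addr0.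
    have -> : c S' + c (i |: S') * x i + (c S' - c (i |: S') * x i) = c S' * 2.
      ring.
    by rewrite mulf_eq0 (negPf two0) orbF.
  split=> //; move/eqP: e1; rewrite c0 add0r mulf_eq0 (negPf (x0 i)) orbF.
  by move/eqP.
have [iS|iS] := boolP (i \in S).
  by rewrite -(finset.setD1K iS); apply: (both _ _).2; apply: finset.setSD.
by apply: (both _ _).1; rewrite subsetD1 ST.
Qed.

Lemma horner_at_sqrt (E L : fieldType) (phi : {rmorphism E -> L}) a z
    (p : {poly E}) : z ^+ 2 = phi a ->
  exists r s, (map_poly phi p).[z] = phi r + phi s * z.
Proof.
move=> z2; elim/poly_ind: p => [|p c [r [s e]]].
  by exists 0, 0; rewrite map_poly0 horner0 rmorph0 mul0r addr0.
exists (s * a + c), r.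
rewrite rmorphD rmorphM /= map_polyX map_polyC hornerMXaddC e.
by rewrite rmorphD rmorphM /= -z2; ring.
Qed.

Lemma adjoin_sqrt (E : fieldType) (a : E) : (forall u, u ^+ 2 != a) ->
  exists (L : fieldType) (phi : {rmorphism E -> L}) (z : L),
    z ^+ 2 = phi a /\ forall w, exists p q, w = phi p + phi q * z.
Proof.
move=> nsq; pose P : {poly E} := 'X^2 - a%:P.
have sP : size P = 3.
  by rewrite size_polyDl size_polyXn // size_polyN (leq_ltn_trans (size_polyC_leq1 _)).
have irrP : irreducible_poly P.
  apply: cubic_irreducible; rewrite ?sP // => u.
  by rewrite rootE hornerD hornerN hornerC hornerXn subr_eq0.
have [L _ [z rz fz]] := irredp_FAdjoin irrP.
pose phi : {rmorphism E -> L} := in_alg L.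
have z2 : z ^+ 2 = phi a.
  move: rz; rewrite rootE rmorphB /= map_polyXn map_polyC hornerD hornerN.
  by rewrite hornerC hornerXn subr_eq0 => /eqP.
exists L, phi, z; split=> // w.
have : w \in <<1; z>>%VS by rewrite fz memvf.
move=> /Fadjoin1_polyP[p ->]; exact: (@horner_at_sqrt E L phi a z p z2).
Qed.

(** If [(p + q z)^2] lies in [E], the cross term [2 p q z] does too, which forces [p q = 0] as [z]
    is not in [E]. Then [b = p^2] or [b = a q^2]. *)
Lemma square_in_adjoin_sqrt (E L : fieldType) (phi : {rmorphism E -> L}) a b z :
  2 != 0 :> E -> (forall u, u ^+ 2 != a) ->
  z ^+ 2 = phi a -> (forall w, exists p q, w = phi p + phi q * z) ->
  (exists w, w ^+ 2 = phi b) -> exists u, u ^+ 2 = b \/ u ^+ 2 = a * b.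
Proof.
move=> two0 nsq z2 gen [w]; have [p [q ->]] := gen w.
have two0' : phi 2 != 0 by rewrite fmorph_eq0.
move=> e; have [pq0|pq0] := eqVneq (p * q) 0; last first.
  have : phi (2 * p * q) * z = phi (b - p ^+ 2 - a * q ^+ 2).
    rewrite !rmorphB !rmorphM /= -e -z2 rmorph_nat; ring.
  move=> h; case/eqP: (nsq ((b - p ^+ 2 - a * q ^+ 2) / (2 * p * q))).
  apply: (fmorph_inj phi); rewrite rmorphXn fmorph_div -h mulrAC divff ?mul1r //.
  by rewrite fmorph_eq0 -mulrA mulf_neq0.
move/eqP: pq0; rewrite mulf_eq0 => /orP[]/eqP z0.
  exists (a * q); right; apply: (fmorph_inj phi).
  by rewrite rmorphXn !rmorphM /= -e -z2 z0 rmorph0; ring.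
by exists p; left; apply: (fmorph_inj phi); rewrite rmorphXn -e z0 rmorph0; ring.
Qed.

(** One root is adjoined at a time. Assuming nonsquares for all nonempty products makes the
    induction work: if the product over [S] became a square after adjoining the root of [f i], the
    product over [S] or over [i |: S] would already be one. *)
Lemma sqrt_tower (I : finType) (E : fieldType) (f : I -> E) (T : {set I}) :
  2 != 0 :> E ->
  (forall (S : {set I}) u, S \subset T -> S != finset.set0 ->
    u ^+ 2 != \prod_(j in S) f j) ->
  exists (L : fieldType) (phi : {rmorphism E -> L}) (y : I -> L),
    (forall i, i \in T -> y i ^+ 2 = phi (f i)) /\
    forall c : {set I} -> E,
      \sum_(S in powerset T) phi (c S) * \prod_(j in S) y j = 0 ->
      forall S : {set I}, S \subset T -> c S = 0.
Proof.
move: {2}#|T| (erefl #|T|) => k; elim: k T E f => [|k IHk] T E f cT two0 nsq.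
  exists E, idfun, (fun=> 0).
  move/eqP: cT; rewrite cards_eq0 => /eqP ->; split=> [i|c].
    by rewrite inE.
  by rewrite powerset0 big_set1 big_set0 mulr1 /= => c0 S; rewrite finset.subset0 => /eqP ->.
have /card_gt0P[i iT] : (0 < #|T|)%N by rewrite cT.
have cT' : #|T :\ i| = k by move: cT; rewrite (cardsD1 i) iT => -[].
have nsqi u : u ^+ 2 != f i.
  have := nsq [set i]%SET u; rewrite big_set1 finset.sub1set; apply=> //.
  by apply/set0Pn; exists i; rewrite inE.
have [E' [phi [z [z2 gen]]]] := adjoin_sqrt nsqi.
have two0' : 2 != 0 :> E' by rewrite -(rmorph_nat phi) fmorph_eq0.
have [|L [psi [y [y2 ind]]]] := IHk (T :\ i) E' (phi \o f) cT' two0'.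
  move=> S u /[dup] ST; rewrite subsetD1 => /andP[ST' iS] S0.
  apply/eqP => e.
  have [|w [e'|e']] := square_in_adjoin_sqrt (b := \prod_(j in S) f j) two0 nsqi z2 gen.
  - by exists u; rewrite e rmorph_prod.
  - by have := nsq S w (fintype.subset_trans ST (subsetDl _ _)) S0; rewrite e' eqxx.
  have sT : i |: S \subset T by rewrite finset.subUset finset.sub1set iT.
  have s0 : i |: S != finset.set0 by apply/set0Pn; exists i; rewrite finset.setU11.
  by have := nsq _ w sT s0; rewrite big_setU1 //= e' eqxx.
exists L, (psi \o phi), (fun j => if j == i then psi z else y j); split.
  move=> j jT; case: eqP => [->|/eqP ji]; first by rewrite -rmorphXn z2.
  by rewrite y2 // !inE ji.
move=> c; rewrite (sum_powerset_setD1 _ iT) => h.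
have both (S : {set I}) : S \subset T :\ i -> c S = 0 /\ c (i |: S) = 0.
  move=> hS.
  have e : phi (c S) + phi (c (i |: S)) * z = 0.
    apply: (ind (fun S => phi (c S) + phi (c (i |: S)) * z)) => //.
    rewrite -[RHS]h; apply: eq_bigr => S'; rewrite powersetE subsetD1 => /andP[_ iS'].
    have eS' : \prod_(j in S') (if j == i then psi z else y j) = \prod_(j in S') y j.
      by apply: eq_bigr => j jS'; case: eqP => // ji; rewrite -ji jS' in iS'.
    by rewrite big_setU1 //= eqxx eS' rmorphD rmorphM mulrDl mulrA.
  (* Otherwise [z] would be the image of an element of [E], and [f i] would be a square. *)
  have c0 : c (i |: S) = 0.
    apply/eqP; apply: contraT => c0; case/eqP: (nsqi (- c S / c (i |: S))).
    apply: (fmorph_inj phi); rewrite rmorphXn fmorph_div rmorphN -z2.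
    congr (_ ^+ 2); apply: (mulfI (_ : phi (c (i |: S)) != 0)).
      by rewrite fmorph_eq0.
    rewrite mulrCA divff ?fmorph_eq0 // mulr1; apply/esym/eqP.
    by rewrite -addr_eq0 addrC e.
  by split=> //; move: e; rewrite c0 rmorph0 mul0r addr0 => /eqP; rewrite fmorph_eq0 => /eqP.
move=> S ST; have [iS|iS] := boolP (i \in S).
  by rewrite -(finset.setD1K iS); apply: (both _ _).2; apply: finset.setSD.
by apply: (both _ _).1; rewrite subsetD1 ST.
Qed.

End SquareRootTowers.

(** * Nonsquares in fraction fields of polynomial rings *)

Section Nonsquares.

Lemma frac_quotient (R : idomainType) (u : {fraction R}) :
  exists p q : R, q != 0 /\ u * FracField.tofrac q = FracField.tofrac p.
Proof.
elim/quotW: u => x; exists (frac x).1, (frac x).2; split; first exact: denom_ratioP.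
unlock FracField.tofrac; rewrite -[LHS]FracField.pi_mul; apply/eqmodP => /=.
rewrite FracField.equivfE /FracField.mulf !numden_Ratio ?mulf_neq0 ?denom_ratioP ?oner_neq0 //.
by rewrite !mulr1 mulrC.
Qed.

(** The multiplicity of [a] is even on the left and odd on the right. *)
Lemma odd_root_nonsquare (R : idomainType) (p q g : {poly R}) a : q != 0 -> ~~ root g a ->
  p ^+ 2 != q ^+ 2 * (('X - a%:P) * g).
Proof.
move=> q0 ga; apply/eqP => e.
have X0 : 'X - a%:P != 0 by rewrite polyXsubC_eq0.
have g0 : g != 0 by apply: contraNneq ga => ->; rewrite root0.
have p0 : p != 0.
  by rewrite -sqrf_eq0 e !mulf_neq0 // expf_neq0.
have [m [p1 p1a ep]] := multiplicity_XsubC p a.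
have [k [q1 q1a eq]] := multiplicity_XsubC q a.
rewrite p0 /= in p1a; rewrite q0 /= in q1a.
rewrite ep eq in e; set l := 'X - a%:P in X0 e.
have la : root l a by rewrite root_XsubC.
have [mk|km] := leqP m k.
  have : p1 ^+ 2 = l * (q1 ^+ 2 * g * (l ^+ (k - m)) ^+ 2).
    apply: (mulfI (expf_neq0 2 (expf_neq0 m X0))); rewrite -/l.
    transitivity ((p1 * l ^+ m) ^+ 2); first ring.
    by rewrite e -{1}(subnKC mk) exprD; ring.
  move=> /(congr1 (fun h => root h a)); rewrite [RHS]rootM la expr2 rootM.
  by rewrite (negPf p1a).
have : q1 ^+ 2 * g = l * (p1 ^+ 2 * (l ^+ (m - k.+1)) ^+ 2).
  apply: (mulfI (mulf_neq0 X0 (expf_neq0 2 (expf_neq0 k X0)))); rewrite -/l.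
  transitivity ((q1 * l ^+ k) ^+ 2 * (l * g)); first ring.
  by rewrite -e -{1}(subnKC km) exprD (exprS l); ring.
move=> /(congr1 (fun h => root h a)); rewrite [RHS]rootM la expr2 !rootM.
by rewrite (negPf q1a) (negPf ga).
Qed.

(** Any [r i] with [i] in [S] is a simple root of the product, so clearing the denominator of [u]
    contradicts the parity of its multiplicity. *)
Lemma prod_linear_nonsquare (R : idomainType) (I : finType) (e r : I -> R) (S : {set I})
    (u : {fraction {poly R}}) :
  injective r -> (forall j, e j != 0) -> S != finset.set0 ->
  u ^+ 2 != \prod_(j in S) FracField.tofrac ((e j)%:P * ('X - (r j)%:P)).
Proof.
move=> r_inj e0 /set0Pn[i iS]; have [p [q [q0 eu]]] := frac_quotient u.
rewrite -rmorph_prod (bigD1 i) //=; apply/eqP => eu2.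
pose g := (e i)%:P * \prod_(j in S | j != i) ((e j)%:P * ('X - (r j)%:P)).
have rC j : root (e j)%:P (r i) = false.
  by rewrite rootC (negPf (e0 j)).
have gi : ~~ root g (r i).
  rewrite rootM rC /= /root horner_prod; apply/prodf_neq0 => j /andP[_ ji].
  rewrite -/(root _ _) rootM rC root_XsubC eq_sym.
  by apply: contraNneq ji => /r_inj ->.
case/eqP: (odd_root_nonsquare p q0 gi).
apply/eqP; rewrite -tofrac_eq; apply/eqP.
rewrite rmorphXn /= -eu exprMn eu2 [RHS]rmorphM rmorphXn /= /g mulrC.
by congr (_ * FracField.tofrac _); rewrite [RHS]mulrCA mulrA.
Qed.

End Nonsquares.

(** * Polynomials vanishing at all points *)

Section Vanishing.

Lemma poly_nat_roots (R : idomainType) (p : {poly R}) :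
  injective (fun i : nat => i%:R : R) -> (forall i : nat, p.[i%:R] = 0) -> p = 0.
Proof.
move=> inj hp; apply: (@roots_geq_poly_eq0 _ p [seq i%:R | i <- iota 0 (size p)]).
- by apply/allP => _ /mapP[i _ ->]; rewrite rootE hp.
- by rewrite map_inj_uniq ?iota_uniq.
- by rewrite size_map size_iota.
Qed.

Lemma bivariate_vanishing (K : numFieldType) (p : {poly {poly K}}) :
  (forall t a, (p.[a%:P]).[t] = 0) -> p = 0.
Proof.
have inj : injective (fun i : nat => i%:R : K) by exact: mulrIn (oner_neq0 _).
move=> hp; apply: poly_nat_roots => [i j /(congr1 (fun q : {poly K} => q.[0]))|i].
  by rewrite -!polyC_natr !hornerC => /inj.
by apply: poly_nat_roots => // j; rewrite -polyC_natr hp.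
Qed.

End Vanishing.

(** * Reduction modulo square relations *)

Section ParityNormalForm.
Variables (K : comNzRingType) (N : nat) (A : comNzRingType).
Variables (kappa : {rmorphism K -> A}) (g f : 'I_N -> A).

(* The coefficient of \prod_(j in S) y_j in F(g_1 y_1, ..., g_N y_N) reduced
   modulo the relations y_j^2 = f_j. *)
Definition parity_coef (F : {mpoly K[N]}) (S : {set 'I_N}) : A :=
  \sum_(m <- msupp F | [set j | odd (m j)]%SET == S)
    kappa F@_m * \prod_j (g j ^+ m j * f j ^+ (m j)./2).

(** A power of [y j] is [y j] to the parity of the exponent times a power of [phi (f j)], so each
    monomial contributes to the set of its odd exponents. *)
Lemma mmap_parity_coef (B : comNzRingType) (phi : {rmorphism A -> B})
    (y : 'I_N -> B) (F : {mpoly K[N]}) :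
  (forall j, y j ^+ 2 = phi (f j)) ->
  mmap (phi \o kappa) (fun j => phi (g j) * y j) F =
  \sum_(S in powerset finset.setT) phi (parity_coef F S) * \prod_(j in S) y j.
Proof.
move=> y2; rewrite /mmap.
under [RHS]eq_bigr do rewrite /parity_coef rmorph_sum mulr_suml.
rewrite (exchange_big_dep xpredT) //=; apply: eq_bigr => m _.
rewrite (eq_bigl (fun S => S == [set j | odd (m j)]%SET)); last first.
  by move=> S; rewrite powersetE finset.subsetT eq_sym.
rewrite big_pred1_eq rmorphM /= -mulrA; congr (_ * _).
rewrite rmorph_prod /mmap1 [X in _ * X]big_mkcond -big_split /=; apply: eq_bigr => j _.
rewrite inE rmorphM !rmorphXn /= -y2 exprMn -mulrA; congr (_ * _).
rewrite -exprM -{1}(odd_double_half (m j)) exprD mulrC mul2n.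
by case: odd; rewrite ?expr1 ?expr0.
Qed.

End ParityNormalForm.

(** * Irreducibility of the cover by square roots *)

Section SquareRootCover.
Variables (K : numClosedFieldType) (N : nat).
Variables (e : 'I_N -> K) (r g : 'I_N -> {poly K}) (D : {poly K}).
Hypotheses (e_neq0 : forall j, e j != 0) (r_inj : injective r) (D_neq0 : D != 0).

Lemma sqrt_cover_irreducible (F G : {mpoly K[N]}) :
  (forall t a (x : 'I_N -> K), D.[t] != 0 -> (forall j, x j != 0) ->
    (forall j, x j ^+ 2 = e j * (a - (r j).[t])) ->
    (F * G).@[fun j => (g j).[t] * x j] = 0) ->
  let vanishes H := forall t a (x : 'I_N -> K),
    (forall j, x j ^+ 2 = e j * (a - (r j).[t])) ->
    H.@[fun j => (g j).[t] * x j] = 0 in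
  vanishes F \/ vanishes G.
Proof.
move=> FG0 vanishes.
pose A : comNzRingType := {poly {poly K}}.
pose kappa : {rmorphism K -> A} := polyC \o polyC.
pose ev t a : {rmorphism A -> K} := horner_eval t \o horner_eval a%:P.
(* The outer variable is [a], the inner one [t]. *)
pose f (j : 'I_N) : {poly {poly K}} := (e j)%:P%:P * ('X - (r j)%:P).
pose c := parity_coef kappa (fun j => (g j)%:P) f.
have evf t a j : ev t a (f j) = e j * (a - (r j).[t]).
  by rewrite /ev /= /horner_eval !hornerE.
have ev_meval H t a (x : 'I_N -> K) :
    (forall j, x j ^+ 2 = e j * (a - (r j).[t])) ->
    H.@[fun j => (g j).[t] * x j] =
    \sum_(S in powerset finset.setT) ev t a (c H S) * \prod_(j in S) x j.
  move=> hx; rewrite -mmap_parity_coef => [|j]; last by rewrite hx evf.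
  rewrite /meval /mmap; apply: eq_bigr => m _; congr (_ * _).
    by rewrite /= /horner_eval !hornerC.
  by apply: mmap1_eq => j; rewrite /= /horner_eval hornerC.
have two0 (R : fieldType) (phi : {rmorphism K -> R}) : 2 != 0 :> R.
  by rewrite -(rmorph_nat phi) fmorph_eq0 pnatr_eq0.
have f0 j : f j != 0 by rewrite mulf_neq0 ?polyC_eq0 ?polyXsubC_eq0.
have c0 S : c (F * G) S = 0.
  (* The extra factor vanishes at the points [(t, a)] where the hypothesis says nothing. At the
     others every choice of signs of the roots is admissible, so [sign_independence] isolates each
     coefficient. *)
  suff /eqP : c (F * G) S * (D%:P * \prod_j f j) = 0.
    rewrite !mulf_eq0 polyC_eq0 (negPf D_neq0) /= => /orP[/eqP //|].
    by move/eqP/eqP; apply: contraTeq => _; apply/prodf_neq0.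
  apply: bivariate_vanishing => t a; rewrite -[LHS]/(ev t a _) !rmorphM rmorph_prod /=.
  have [Dt|Dt] := eqVneq D.[t] 0.
    by rewrite /horner_eval hornerC Dt mul0r mulr0.
  have [/existsP[j /eqP fj]|/existsPn nz] := boolP [exists j, ev t a (f j) == 0].
    by rewrite (bigD1 j) //= [X in _ * (_ * (X * _))]fj mul0r !mulr0.
  have s0 j : sqrtC (ev t a (f j)) != 0 by rewrite sqrtC_eq0.
  suff h : ev t a (c (F * G) S) = 0 by rewrite [X in X * _]h mul0r.
  apply: (sign_independence (two0 K idfun) s0 (T := finset.setT)
    (c := fun S => ev t a (c (F * G) S))) (finset.subsetT S) => x hx.
  have hx' j : x j ^+ 2 = e j * (a - (r j).[t]).
    by rewrite hx sqrtCK evf.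
  rewrite -ev_meval //; apply: (FG0 t a) => // j.
  by rewrite -sqrf_eq0 hx sqrtCK.
pose iota : {rmorphism A -> {fraction {poly {poly K}}}} := @FracField.tofrac {poly {poly K}}.
have [|S u _ S0|L [phi [y [y2 ind]]]] :=
    @sqrt_tower 'I_N {fraction {poly {poly K}}} (fun j => iota (f j)) finset.setT.
- exact: (two0 _ (iota \o kappa)).
- by apply: prod_linear_nonsquare => // j; rewrite polyC_eq0.
pose psi : {rmorphism A -> L} := phi \o iota.
have y2' j : y j ^+ 2 = psi (f j) by rewrite y2 ?finset.in_setT.
pose z j := psi (g j)%:P * y j.
have expand H := @mmap_parity_coef K N A kappa (fun j => (g j)%:P) f L psi y H y2'.
(* Vanishing at the generic point kills all parity coefficients, hence all specializations,
   including those with [D.[t] = 0] or some [x j = 0]. *)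
have vanish H : mmap (psi \o kappa) z H = 0 -> vanishes H.
  rewrite expand => /ind h t a x hx; rewrite (ev_meval _ _ a) // big1 // => S _.
  suff -> : c H S = 0 by rewrite rmorph0 mul0r.
  by apply/eqP; rewrite -tofrac_eq0; apply/eqP/(h S)/finset.subsetT.
have /eqP : mmap (psi \o kappa) z (F * G) = 0.
  by rewrite expand big1 // => S _; rewrite -/(c _ S) c0 rmorph0 mul0r.
by rewrite rmorphM mulf_eq0 => /orP[]/eqP/vanish; [left|right].
Qed.

End SquareRootCover.

(** * Interpolation weights *)

Section LagrangeWeights.
Variables (K : fieldType) (N : nat) (lam : 'I_N.+1 -> K).
Hypothesis lam_inj : injective lam.

(** With [e_j = 1 / Q'(lam_j)], [L(e)] is the interpolation polynomial of the constant 1, so its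
    degree drops by [N]. *)
Lemma lagrange_weights : exists2 e : 'I_N.+1 -> K, forall j, e j != 0 &
  forall r, (r < N)%N -> \sum_j lam j ^+ r * e j = 0.
Proof.
pose q j := \prod_(l | l != j) ('X - (lam l)%:P).
pose e j := (q j).[lam j]^-1.
have e0 j : e j != 0 by rewrite invr_eq0 node_prod_neq0.
exists e => //.
have L1 : lagrange_sum lam e = 1.
  apply/eqP; rewrite -subr_eq0; apply/eqP.
  apply: (@roots_geq_poly_eq0 _ _ (codom lam)).
  - apply/allP => _ /codomP[i ->]; rewrite rootE hornerD hornerN hornerC.
    by rewrite horner_lagrange_sum mulVf ?subrr // node_prod_neq0.
  - by apply/injectiveP.
  rewrite size_codom card_ord (leq_trans (size_polyD _ _)) // geq_max.
  by rewrite size_lagrange_sum_le size_polyN size_poly1.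
by apply: (size_lagrange_sum _ _ (leqnSn N)).1; rewrite L1 size_poly1 subSnn.
Qed.

End LagrangeWeights.

Lemma meval_dhomogZ (K : comNzRingType) N d c (v : 'I_N -> K) (F : {mpoly K[N]}) :
  F \is d.-homog -> F.@[fun j => c * v j] = c ^+ d * F.@[v].
Proof.
move=> /dhomogP hF; rewrite !mevalE mulr_sumr; apply: eq_big_seq => m /hF <-.
rewrite mulrCA /= mdegE expr_sum -big_split /=; congr (_ * _).
by apply: eq_bigr => j _; rewrite exprMn.
Qed.

(** * Irreducibility of W *)

Section Irreducibility.
Variables (K : numClosedFieldType) (n : nat) (lam : 'I_n.+3 -> K).
Hypotheses (n_ge3 : (3 <= n)%N) (lam_inj : injective lam).

(* The surface x_j^2 = e_j (a - r_j(t)) passes at (t, a) = (0, 0) and (1, 0)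
   through the two prescribed points. *)
Lemma W_irreducible : zariski_irreducible (W lam_inj).
Proof.
have n2 : (2 <= n)%N by apply: leq_trans n_ge3.
have [e e0 me] := lagrange_weights lam_inj.
split.
  pose y : 'rV[K]_n.+3 := \row_j sqrtC (e j).
  have y0 : y != 0.
    by apply/rV0Pn; exists 0; rewrite mxE sqrtC_eq0.
  have my : Zvar lam (mkpt y0).
    apply/diag_quadricsE => r; have r4 := ltn_ord r.
    rewrite -[RHS](me r); last by lia.
    by apply: eq_bigr => j _; rewrite mxE sqrtCK.
  have v0 : (\row__ 1 : 'rV[K]_2) != 0.
    by apply/rV0Pn; exists 0; rewrite mxE oner_neq0.
  pose z : Zvar lam := exist _ (mkpt y0) (mem_set my).
  by exists (nu lam_inj (mkpt v0, z)); apply/(WP n2)/range_nuP; exists (mkpt v0, z).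
move=> B C [SB [hB ->]] [SC [hC ->]] WBC.
apply: contrapT => /not_orP[/existsNP[p /not_implyP[Wp]] + /existsNP[q /not_implyP[Wq]]].
move=> /existsNP[F /not_implyP[SF /eqP Fp]] /existsNP[G /not_implyP[SG /eqP Gq]].
have [v [y my epv]] := (WP n2 lam_inj p).1 Wp.
have [v' [y' my' epv']] := (WP n2 lam_inj q).1 Wq.
have [dF hF] := hB _ SF; have [dG hG] := hC _ SG.
have v0 : v != 0.
  by apply: contraNneq (coords_neq0 p) => v0; rewrite epv v0 nu_row_eq0l.
have [i vi] := rV0Pn _ v0.
(* The segment from [v] to [v']; its coordinate [i] is a nonzero polynomial and serves as [D],
   keeping the moving point nonzero. *)
pose pth k : {poly K} := (v 0 k)%:P + (v' 0 k - v 0 k) *: 'X.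
pose g j := lam j *: pth 1 - pth 0.
(* The last term interpolates between [y_j^2] and [y'_j^2]; the first vanishes at both ends, and its
   quadratic coefficient [lam j] makes the [r j] distinct. *)
pose r j : {poly K} := lam j *: ('X^2 - 'X) -
  (e j)^-1 *: ((y 0 j ^+ 2)%:P + (y' 0 j ^+ 2 - y 0 j ^+ 2) *: 'X).
have r_inj : injective r.
  move=> j k /(congr1 (fun s : {poly K} => s`_2)).
  rewrite /r !coefB !coefZ !coefD !coefN !coefC !coefZ !coefXn !coefX /=.
  by rewrite !(mulr0, addr0, oppr0, subr0, mulr1) => /lam_inj.
have D0 : pth i != 0.
  apply: contraNneq vi => /(congr1 (fun s => s.[0])).
  by rewrite /pth !hornerE => ->.
have fE t a j : e j * (a - (r j).[t]) =
    e j * a + e j * (lam j * (t - t ^+ 2))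
    + (y 0 j ^+ 2 + (y' 0 j ^+ 2 - y 0 j ^+ 2) * t).
  have -> : (r j).[t] = lam j * (t ^+ 2 - t) -
      (e j)^-1 * (y 0 j ^+ 2 + (y' 0 j ^+ 2 - y 0 j ^+ 2) * t).
    by rewrite /r !hornerE.
  by rewrite -[X in _ = _ + X]mul1r -(divff (e0 j)); ring.
have [t a x Dt x0 hx|FP|GP] := sqrt_cover_irreducible (g := g) e0 r_inj D0 (F := F) (G := G).
- pose V : 'rV[K]_2 := \row_k (pth k).[t].
  pose Y : 'rV[K]_n.+3 := \row_j x j.
  have V0 : V != 0 by apply/rV0Pn; exists i; rewrite mxE.
  have Y0 : Y != 0 by apply/rV0Pn; exists 0; rewrite mxE.
  have mY : Zvar lam (mkpt Y0).
    apply/diag_quadricsE => s.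
    (* The term [lam j * e j] raises exponents to 4, and the weights annihilate those below [n + 2];
       this uses [n >= 3]. *)
    have s1 : (s.+1 < n.+2)%N by apply: (@leq_ltn_trans 4).
    transitivity ((a * \sum_j lam j ^+ s * e j
       + (t - t ^+ 2) * \sum_j lam j ^+ s.+1 * e j)
       + ((1 - t) * \sum_j lam j ^+ s * y 0 j ^+ 2
       + t * \sum_j lam j ^+ s * y' 0 j ^+ 2)).
      rewrite !mulr_sumr -!big_split /=; apply: eq_bigr => j _.
      by rewrite mxE hx fE (exprS (lam j) s) /=; ring.
    by rewrite !me ?(ltnW s1) // my my' !mulr0 !addr0.
  pose zY : Zvar lam := exist _ (mkpt Y0) (mem_set mY).
  have w0 : nu_row lam V Y != 0.
    by apply: nu_row_neq0 => //; rewrite -[RHS]((diag_quadricsE lam 4 Y0).1 mY 0);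
      apply: eq_bigr => j _; rewrite mul1r.
  have gx H : H.@[nu_row lam V Y 0] = H.@[fun j => (g j).[t] * x j].
    apply: meval_eq => j; by rewrite !mxE /g /pth !hornerE; ring.
  have WV : W lam_inj (mkpt w0).
    by apply/(WP n2)/range_nuP; exists (mkpt V0, zY) => //; apply: nuE.
  have [c c0 ec] := coords_mkpt w0.
  have cH d (H : {mpoly K[n.+3]}) : H \is d.-homog ->
      H.@[coords (mkpt w0) 0] = 0 -> H.@[fun j => (g j).[t] * x j] = 0.
    move=> hH; rewrite ec (meval_eq (v2 := fun j => c * nu_row lam V Y 0 j)).
      rewrite (meval_dhomogZ _ _ hH) gx => /eqP; rewrite mulf_eq0 expf_eq0 (negPf c0).
      by rewrite andbF => /eqP.
    by move=> j; rewrite mxE.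
  rewrite mevalM; case: (WBC _ WV) => [/(_ F SF)/(cH _ _ hF) ->|/(_ G SG)/(cH _ _ hG) ->].
    by rewrite mul0r.
  by rewrite mulr0.
(* At [(t, a) = (0, 0)] the choice [x = y] gives [p]; at [(1, 0)] the choice [x = y'] gives [q]. *)
- case/eqP: Fp; rewrite -[RHS](FP 0 0 (fun j => y 0 j)) => [|j].
    by apply: meval_eq => j; rewrite epv mxE /g /pth !hornerE; ring.
  by rewrite fE; ring.
case/eqP: Gq; rewrite -[RHS](GP 1 0 (fun j => y' 0 j)) => [|j].
  by apply: meval_eq => j; rewrite epv' mxE /g /pth !hornerE /=; ring.
by rewrite fE; ring.
Qed.

End Irreducibility.

Unset Implicit Arguments.

Theorem proposition2p3 (R : realType) (n : nat) (hn : (2 <= n)%N)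
    (lam : 'I_n.+3 -> R[i]) (hlam : injective lam) :
  range (nu hlam) = W hlam /\
  ((3 <= n)%N -> zariski_irreducible (W hlam)).
Proof.
split=> [|n3]; last exact: W_irreducible.
by apply/seteqP; split=> x; rewrite range_nuP WP.
Qed.
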